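(* Let $$S=\langle a,b,c,d,s \mid [a,c]=[a,d]=[b,c]=[b,d]=1,\ (a^{-1}b)^s=a^{-1}b,\ (a^{-1}c)^s=a^{-1}c,\ (a^{-1}d)^s=a^{-1}d\rangle$$ be Stallings' group, and let $X=\{a,b,c,d,s,a^{-1},b^{-1},c^{-1},d^{-1},s^{-1}\}$. Then $(S,X)$ is not $MAC$, i.e. $S$ is not $MAC$ with respect to the generating set $X$.
   Context: Notation: $[x,y]:=xyx^{-1}y^{-1}$ and $x^s:=sxs^{-1}$ (so the last three relations say that $s$ commutes with $a^{-1}b$, $a^{-1}c$ and $a^{-1}d$). For a group $G$ with finite generating set $A$, let $\Gamma$ be the corresponding Cayley graph, regarded as a metric graph with path metric $d$ (each edge has length 1), and let $S(r)$ and $B(r)$ denote the sphere and the (closed) ball of radius $r$ in $\Gamma$ centred at the identity vertex. For a function $f:\mathbb{N}\to\mathbb{R}_+$ and $r_0\in\mathbb{N}$, the pair $(G,A)$ satisfies the condition $AC_{f,r_0}$ if for every natural number $r\ge r_0$ and every pair of vertices $x,y\in S(r)$ with $d(x,y)\le 2$ there is a path inside $B(r)$ from $x$ to $y$ of length at most $f(r)$. The pair $(G,A)$ is minimally almost convex, or $MAC$, if $AC_{f,r_0}$ holds for the function $f(r)=2r-1$ and some $r_0\in\mathbb{N}$. *)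

(* Defs.v *)
From HB Require Import structures.
From mathcomp Require Import all_boot all_order all_algebra.
From mathcomp Require Import boolp reals.

Set Implicit Arguments.
Unset Strict Implicit.
Unset Printing Implicit Defensive.

Import Order.TTheory GRing.Theory Num.Theory.

(** * Groups given by generators and relations *)

(* A letter (t, false) stands for the generator t, and (t, true) for t^-1. *)
Definition word (T : Type) : Type := seq (T * bool).

Definition linv T (l : T * bool) : T * bool := (l.1, ~~ l.2).
Definition wgen T (t : T) : word T := [:: (t, false)].
Definition wmul T (u v : word T) : word T := u ++ v.
Definition winv T (w : word T) : word T := rev (map (@linv T) w).
Definition wcomm T (x y : word T) : word T :=
  wmul (wmul (wmul x y) (winv x)) (winv y).
(* x^s = s x s^-1 *)
Definition wconj T (x s : word T) : word T := wmul (wmul s x) (winv s).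

(* The congruence on words whose quotient is <T | l = r, (l, r) \in rels>. *)
Inductive pres_eq (T : choiceType) (rels : seq (word T * word T)) :
    word T -> word T -> Prop :=
  | pres_refl w : pres_eq rels w w
  | pres_sym v w : pres_eq rels v w -> pres_eq rels w v
  | pres_trans v u w : pres_eq rels u v -> pres_eq rels v w -> pres_eq rels u w
  | pres_cancel u v l : pres_eq rels (u ++ l :: linv l :: v) (u ++ v)
  | pres_rel u v (lr : word T * word T) : lr \in rels ->
      pres_eq rels (u ++ lr.1 ++ v) (u ++ lr.2 ++ v).

Section PresentedGroup.
Variables (T : choiceType) (rels : seq (word T * word T)).
Local Notation "u ~ v" := (pres_eq rels u v) (at level 70).
Local Open Scope quotient_scope.

Definition pres_eqb (u v : word T) : bool := `[< u ~ v >].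

Lemma pres_eqb_refl : reflexive pres_eqb.
Proof. by move=> w; apply/asboolP; exact: pres_refl. Qed.

Lemma pres_eqb_sym : symmetric pres_eqb.
Proof.
by move=> v w; apply/idP/idP => /asboolP h; apply/asboolP; exact: pres_sym.
Qed.

Lemma pres_eqb_trans : transitive pres_eqb.
Proof.
move=> v u w /asboolP uv /asboolP vw; apply/asboolP; exact: pres_trans uv vw.
Qed.

Canonical pres_equiv :=
  EquivRel pres_eqb pres_eqb_refl pres_eqb_sym pres_eqb_trans.

Definition presented : Type := {eq_quot pres_equiv}.
HB.instance Definition _ := Choice.on presented.
HB.instance Definition _ := EqQuotient.on presented.

Definition pres_class (w : word T) : presented := \pi_presented w.
Definition pres_gen (t : T) : presented := pres_class (wgen t).

Lemma pres_classP u v : pres_class u = pres_class v <-> u ~ v.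
Proof.
split=> [/eqP|h]; first by rewrite /pres_class piE => /asboolP.
by apply/eqP; rewrite /pres_class piE; apply/asboolP.
Qed.

Lemma pres_eq_ctx x y u v : u ~ v -> (x ++ u ++ y) ~ (x ++ v ++ y).
Proof.
elim=> {u v} [w|v w _ ih|v u w _ ih1 _ ih2|u v l|u v lr lr_rels].
- exact: pres_refl.
- exact: pres_sym.
- exact: pres_trans ih1 ih2.
- rewrite -!catA /= !(catA x u); exact: pres_cancel.
- rewrite -!catA !(catA x u); exact: pres_rel.
Qed.

Lemma pres_eq_cat u u' v v' : u ~ u' -> v ~ v' -> wmul u v ~ wmul u' v'.
Proof.
move=> uu' vv'; apply: (pres_trans (v := u' ++ v)).
  exact: (pres_eq_ctx [::] v uu').
by have := pres_eq_ctx u' [::] vv'; rewrite !cats0.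
Qed.

Lemma winv_cat (u v : word T) : winv (u ++ v) = winv v ++ winv u.
Proof. by rewrite /winv map_cat rev_cat. Qed.

Lemma linvK : involutive (@linv T).
Proof. by case=> t b; rewrite /linv negbK. Qed.

Lemma winvK : involutive (@winv T).
Proof. by move=> w; rewrite /winv map_rev revK mapK //; exact: linvK. Qed.

Lemma pres_mulV w : w ++ winv w ~ [::].
Proof.
elim: w => [|l w ih]; first exact: pres_refl.
rewrite -cat1s winv_cat; apply: (pres_trans (v := [:: l] ++ winv [:: l])).
  by have := pres_eq_ctx [:: l] (winv [:: l]) ih; rewrite -!catA.
exact: (pres_cancel rels [::] [::] l).
Qed.

Lemma pres_mulV' w : winv w ++ w ~ [::].
Proof. by have := pres_mulV (winv w); rewrite winvK. Qed.

Lemma pres_eq_inv u v : u ~ v -> winv u ~ winv v.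
Proof.
move=> uv; apply: (pres_trans (v := winv u ++ v ++ winv v)).
  apply: pres_sym; have := pres_eq_cat (pres_refl rels (winv u)) (pres_mulV v).
  by rewrite /wmul cats0.
apply: (pres_trans (v := winv u ++ u ++ winv v)).
  exact: pres_eq_ctx (pres_sym uv).
by have := pres_eq_ctx [::] (winv v) (pres_mulV' u); rewrite /= -catA.
Qed.

Definition pres_one : presented := pres_class [::].
Definition pres_mul (x y : presented) : presented :=
  pres_class (wmul (repr x) (repr y)).
Definition pres_inv (x : presented) : presented := pres_class (winv (repr x)).

Lemma pres_reprK (x : presented) : pres_class (repr x) = x.
Proof. exact: reprK. Qed.

Lemma pres_repr_class w : repr (pres_class w) ~ w.
Proof. by apply/pres_classP; rewrite pres_reprK. Qed.

Lemma pres_class_mul u v :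
  pres_mul (pres_class u) (pres_class v) = pres_class (wmul u v).
Proof. by apply/pres_classP/pres_eq_cat; exact: pres_repr_class. Qed.

Lemma pres_class_inv u : pres_inv (pres_class u) = pres_class (winv u).
Proof. by apply/pres_classP/pres_eq_inv/pres_repr_class. Qed.

Lemma pres_mulgA : associative pres_mul.
Proof.
move=> x y z; rewrite -(pres_reprK x) -(pres_reprK y) -(pres_reprK z).
by rewrite !pres_class_mul /wmul catA.
Qed.

Lemma pres_mul1g : left_id pres_one pres_mul.
Proof. by move=> x; rewrite -(pres_reprK x) pres_class_mul. Qed.

Lemma pres_mulg1 : right_id pres_one pres_mul.
Proof. by move=> x; rewrite -(pres_reprK x) pres_class_mul /wmul cats0. Qed.

Lemma pres_mulVg : left_inverse pres_one pres_inv pres_mul.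
Proof.
move=> x; rewrite -(pres_reprK x) pres_class_inv pres_class_mul.
exact/pres_classP/pres_mulV'.
Qed.

Lemma pres_mulgV : right_inverse pres_one pres_inv pres_mul.
Proof.
move=> x; rewrite -(pres_reprK x) pres_class_inv pres_class_mul.
exact/pres_classP/pres_mulV.
Qed.

HB.instance Definition _ := isGroup.Build presented
  pres_mulgA pres_mul1g pres_mulg1 pres_mulVg pres_mulgV.

End PresentedGroup.

(** * Cayley graphs and almost convexity *)

Section AlmostConvexity.
Variables (G : groupType) (A : seq G).

Definition cayley_adj : rel G :=
  fun x y => has (fun a => (y == x * a)%g || (x == y * a)%g) A.

Definition edge_path (x : G) (p : seq G) (y : G) : Prop :=
  path cayley_adj x p /\ last x p = y.

Definition joined_in (x y : G) (n : nat) : Prop :=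
  exists2 p, edge_path x p y & size p = n.

(* The path metric on vertices; the default value 0 is only taken when x and y
   lie in different components, which cannot happen if A generates G. *)
Definition cdist (x y : G) : nat :=
  if pselect (exists n, `[< joined_in x y n >]) is left h then ex_minn h else 0.

Definition in_sphere (r : nat) (x : G) : Prop := cdist 1%g x = r.

Variable R : realType.
Local Open Scope ring_scope.

(* The distance from the identity to the point at distance t from u on an edge
   {u, v} of the metric graph, for 0 <= t <= 1. *)
Definition edge_point_dist (u v : G) (t : R) : R :=
  Num.min ((cdist 1%g u)%:R + t) ((cdist 1%g v)%:R + (1 - t)).

(* The whole closed edge lies in the closed ball B(r) of the metric graph; an
   edge joining two vertices of S(r) does not. *)
Definition edge_in_ball (r : nat) (u v : G) : Prop :=
  cayley_adj u v /\
  forall t : R, 0 <= t <= 1 -> edge_point_dist u v t <= r%:R.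

(* p lists the successive vertices after x of an edge path, so that its length
   is size p. *)
Definition path_in_ball (r : nat) (x : G) (p : seq G) (y : G) : Prop :=
  [/\ (cdist 1%g x <= r)%N,
      path (fun u v => `[< edge_in_ball r u v >]) x p & last x p = y].

Definition almost_convex (f : nat -> R) (r0 : nat) : Prop :=
  forall r : nat, (r0 <= r)%N ->
  forall x y : G, in_sphere r x -> in_sphere r y -> (cdist x y <= 2)%N ->
  exists2 p, path_in_ball r x p y & (size p)%:R <= f r.

(* The bound is negative at r = 0, but almost_convex f r0 implies
   almost_convex f r0.+1, so only the values at r >= 1 matter. *)
Definition minimally_almost_convex : Prop :=
  exists r0 : nat, almost_convex (fun r => 2 * r%:R - 1) r0.

End AlmostConvexity.

(** * Stallings' group *)

Inductive stallings_letter : Type := La | Lb | Lc | Ld | Ls.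

Definition stallings_code (l : stallings_letter) : nat :=
  match l with La => 0 | Lb => 1 | Lc => 2 | Ld => 3 | Ls => 4 end.
Definition stallings_decode (n : nat) : stallings_letter :=
  match n with 0 => La | 1 => Lb | 2 => Lc | 3 => Ld | _ => Ls end.
Lemma stallings_codeK : cancel stallings_code stallings_decode.
Proof. by case. Qed.
HB.instance Definition _ :=
  Countable.copy stallings_letter (can_type stallings_codeK).

Definition stallings_rels :
    seq (word stallings_letter * word stallings_letter) :=
  let a := wgen La in let b := wgen Lb in let c := wgen Lc in
  let d := wgen Ld in let s := wgen Ls in
  [:: (wcomm a c, [::]); (wcomm a d, [::]);
      (wcomm b c, [::]); (wcomm b d, [::]);
      (wconj (wmul (winv a) b) s, wmul (winv a) b);
      (wconj (wmul (winv a) c) s, wmul (winv a) c);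
      (wconj (wmul (winv a) d) s, wmul (winv a) d)].

Definition stallings : groupType := presented stallings_rels.

Definition stallings_X : seq stallings :=
  let g l : stallings := pres_gen stallings_rels l in
  [:: g La; g Lb; g Lc; g Ld; g Ls;
      (g La)^-1; (g Lb)^-1; (g Lc)^-1; (g Ld)^-1; (g Ls)^-1]%g.

(* Hence the default value in cdist is never taken for stallings_X. *)
Lemma stallings_X_generates (x y : stallings) :
  exists n, joined_in stallings_X x y n.
Proof.
have main w : exists p,
    edge_path stallings_X x p (x * pres_class stallings_rels w)%g.
  elim/last_ind: w => [|w [t b] [p [hp lp]]].
    by exists [::]; split; rewrite //= [RHS]mulg1.
  have -> : pres_class stallings_rels (rcons w (t, b)) =
      (pres_class stallings_rels w * pres_class stallings_rels [:: (t, b)])%g.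
    by rewrite [RHS]pres_class_mul /wmul cats1.
  exists (rcons p (x * (pres_class stallings_rels w *
                        pres_class stallings_rels [:: (t, b)]))%g).
  split; last by rewrite last_rcons.
  rewrite rcons_path hp lp mulgA andTb.
  set g := pres_class _ [:: _].
  apply/hasP; exists g; last by rewrite eqxx.
  have -> : g = if b then ((pres_gen stallings_rels t)^-1)%g
                else pres_gen stallings_rels t.
    by rewrite /g; case: (b) => //; rewrite /pres_gen [RHS]pres_class_inv.
  by case: (t); case: (b); rewrite !inE eqxx ?orbT.
have [p hp] := main (repr (x^-1 * y)%g).
exists (size p), p => //; move: hp.
by rewrite pres_reprK mulgA mulgV mul1g.
Qed.

(* Main.v *)
(* Stallings' group maps onto F(a,b) and F(c,d), killing the other letters, and
   onto F(t,s), with a, b, c, d going to t; so the exponent sum of t is the total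
   exponent sum of the first two images.  With r = 2n, the vertices
   x = s a^-n b^(n-1) and y = a^-n b^n lie on S(r), and x b s^-1 = y since s
   commutes with words of exponent sum 0.  In the tree of F(t,s), a path from x
   to y crosses the edge from s to 1, through an edge from some h s to h.  There
   the images u, v of h have total exponent sum 0, and h s in B(r) gives
   |u| + |v| < 2n.  Then u cannot begin with a^-n, which makes h at distance at
   least 2n from y and h s at distance at least 2n - 1 from x, so the path has
   length at least 4n = 2r. *)

Require Import Defs.
From mathcomp Require Import all_boot all_order all_algebra.
From mathcomp Require Import boolp reals zify.

Set Implicit Arguments.
Unset Strict Implicit.
Unset Printing Implicit Defensive.

Import Order.TTheory GRing.Theory Num.Theory.

(** * Free reduction *)

Section FreeReduction.
Variable T : choiceType.
Implicit Types (l : T * bool) (u v w : word T) (f : T -> int).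

Definition push l w : word T :=
  if w is l' :: w' then if l' == linv l then w' else l :: w else [:: l].

(** For reduced [w], [foldr push w u] is the normal form of the product u w. *)
Definition fred w : word T := foldr push [::] w.

Definition reduced w : bool := sorted (fun l l' => l' != linv l) w.

Lemma push_reduced l w : reduced w -> reduced (push l w).
Proof.
case: w => [|l' w] //=; case: eqP => [_|/eqP nl] rw; last by rewrite /= nl.
exact: path_sorted rw.
Qed.

Lemma foldr_push_reduced u w : reduced w -> reduced (foldr push w u).
Proof. by move=> rw; elim: u => //= l u; exact: push_reduced. Qed.

Lemma fred_reduced w : reduced (fred w).
Proof. exact: foldr_push_reduced. Qed.

Lemma pushK l w : reduced w -> push l (push (linv l) w) = w.
Proof.
case: w => [|l' w] /=; first by rewrite eqxx.
rewrite linvK; case: eqP => [-> | _]; last by rewrite /= eqxx.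
by case: w => [|l2 w] //= /andP[/negbTE->].
Qed.

(** By [pushK], inverse letters act on reduced words by inverse maps, so free cancellation in [u]
    changes nothing. *)
Lemma foldr_push_fred w u : reduced w -> foldr push w (fred u) = foldr push w u.
Proof.
move=> rw; elim: u => //= l u <-.
case: (fred u) => [|l' z] //=; case: eqP => // ->.
by rewrite pushK //; exact: foldr_push_reduced.
Qed.

Lemma fred_cat u v : fred (u ++ v) = foldr push (fred v) (fred u).
Proof. by rewrite foldr_push_fred ?fred_reduced // /fred foldr_cat. Qed.

Lemma size_push l w : size (push l w) <= (size w).+1.
Proof. by case: w => [|l' w] //=; case: ifP => //= _; lia. Qed.

Lemma size_foldr_push w u : size (foldr push w u) <= size u + size w.
Proof. by elim: u => //= l u ih; have := size_push l (foldr push w u); lia. Qed.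

Lemma size_fred w : size (fred w) <= size w.
Proof. by have := size_foldr_push [::] w; rewrite addn0. Qed.

(** A letter appended on the right can cancel only the last letter, which is the head only in a word
    of length 1. *)
Lemma head_foldr_push1 l x w : reduced (x :: w) ->
  ohead (foldr push [:: l] (x :: w)) = Some x \/ w = [::] /\ l = linv x.
Proof.
elim: w x => [|y w ih] x /=; first by case: eqP => [->|_] _; [right|left].
case/andP=> nyx /ih[|[-> ->]] /=; last by rewrite eqxx; left.
by case: (push y _) => //= z v' [->]; rewrite (negbTE nyx); left.
Qed.

(** * Exponent sums *)

Definition esum f w : int := (\sum_(l <- w) (if l.2 then - f l.1 else f l.1))%R.

Lemma esum_cons f l w :
  esum f (l :: w) = ((if l.2 then - f l.1 else f l.1) + esum f w)%R.
Proof. exact: big_cons. Qed.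

Lemma esum_fred f w : esum f (fred w) = esum f w.
Proof.
elim: w => //= l w ih; rewrite esum_cons -ih.
case: (fred w) => [|l' v] /=; first by rewrite esum_cons.
by case: eqP => [->|_]; rewrite !esum_cons //= /linv /=; case: l.2 => /=; lia.
Qed.

Lemma esum1_le_size w : (`|esum (fun=> 1) w| <= (size w)%:Z)%R.
Proof.
elim: w => [|[t b] w ih]; first by rewrite /esum big_nil.
by rewrite esum_cons /=; case: b => /=; lia.
Qed.

Lemma neq_linv l : (l == linv l) = false.
Proof. by case: l => t [] /=; rewrite xpair_eqE andbF. Qed.

(** Copies of [l] cancel against the front of [w] until one fails to; that copy then blocks all
    later ones. *)
Lemma foldr_push_nseq n l w :
  w = nseq n (linv l) ++ foldr push w (nseq n l) \/
  exists i q, [/\ i < n, w = nseq i (linv l) ++ q &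
                  foldr push w (nseq n l) = nseq (n - i) l ++ q].
Proof.
elim: n => [|n [eqw|[i [q [lti eqw eqp]]]]]; first by left.
- rewrite /=; case eqp: (foldr _ _ _) eqw => [|l' z] /= eqw.
    by right; exists n, [::]; split; rewrite // subSn // subnn.
  case: eqP eqw => [-> eqw | _ eqw].
    by left; rewrite [LHS]eqw -cat1s catA -(nseqD n 1) addnC.
  by right; exists n, (l' :: z); split; rewrite // subSn // subnn.
- right; exists i, q; split=> //; first exact: ltnW.
  rewrite /= eqp subSn ?(ltnW lti) //.
  by case: (n - i) (subn_gt0 i n) => [|k _] /=; rewrite ?lti // neq_linv.
Qed.

Lemma foldr_push_neq m l l' w :
  l' != linv l -> foldr push (l' :: w) (nseq m l) = nseq m l ++ l' :: w.
Proof.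
move=> nl; elim: m => //= m ->.
by case: m => [|m] /=; rewrite ?(negbTE nl) ?neq_linv.
Qed.

Lemma fred_nseq n l : fred (nseq n l) = nseq n l.
Proof.
by elim: n => //= -[|n] ih //; rewrite ih /= neq_linv.
Qed.

Lemma fred_nseq2 m n l l' : l' != linv l ->
  fred (nseq m l ++ nseq n l') = nseq m l ++ nseq n l'.
Proof.
move=> nl; rewrite /fred foldr_cat -!/(fred _) fred_nseq.
case: n => [|n] /=; last exact: foldr_push_neq.
by rewrite cats0 -[RHS]fred_nseq.
Qed.

Lemma nseqSr n l : nseq n.+1 l = nseq n l ++ [:: l].
Proof. by rewrite -addn1 nseqD. Qed.

Lemma fred_nseqV n l : fred (nseq n (linv l) ++ nseq n l) = [::].
Proof.
elim: n => // n ih; rewrite nseqSr -catA fred_cat /=.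
by rewrite -{2}(linvK l) pushK ?fred_reduced // -fred_cat.
Qed.

(* Unless w starts with l^-n, the word l1^m l^n keeps its last n - i >= 1
   letters in the product, so the i letters cancelled cost at most i steps of
   v; if w does start with l^-n, then e(w) + e(v) = 0 makes the pair long. *)
Lemma size_foldr_push_far m n l l1 w v : l.2 = false -> l != linv l1 ->
  (esum (fun=> 1) w + esum (fun=> 1) v = 0)%R -> size w + size v < 2 * n ->
  m + n <= size (foldr push w (nseq m l1 ++ nseq n l)) + size v.
Proof.
move=> l2 nl1 e0 lt2n; rewrite foldr_cat.
have esumD i q : (esum (fun=> 1) (nseq i (linv l) ++ q) =
    esum (fun=> 1) q - i%:Z)%R.
  by elim: i => [|i ih] /=; rewrite ?subr0 // esum_cons ih /= l2 /=; lia.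
have lv := esum1_le_size v.
case: (foldr_push_nseq n l w) => [eqw|[i [q [lti eqw ->]]]].
  move: e0 lt2n; rewrite eqw esumD size_cat size_nseq.
  by have := esum1_le_size (foldr push w (nseq n l)); lia.
move: e0; rewrite eqw esumD; have := esum1_le_size q.
case: (n - i) (subnK (ltnW lti)) => [|k] /= eqn; first lia.
by rewrite foldr_push_neq //= size_cat /= size_cat !size_nseq; lia.
Qed.

End FreeReduction.

(** * Presented groups and their free quotients *)

Section Presentation.
Variables (T T' : choiceType) (rels : seq (word T * word T)).
Variable f : T -> option T'.

Definition proj (w : word T) : word T' :=
  pmap (fun l => omap (fun t => (t, l.2)) (f l.1)) w.

Lemma proj_cat u v : proj (u ++ v) = proj u ++ proj v.
Proof. exact: pmap_cat. Qed.

Lemma proj_nseq n l :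
  proj (nseq n l) = if f l.1 is Some t then nseq n (t, l.2) else [::].
Proof.
elim: n => [|n ih] /=; first by case: f.
by rewrite -/(proj _) ih; case: (f l.1).
Qed.

(** Von Dyck's theorem for a free target, with reduced words as its elements. *)
Lemma fred_proj_pres_eq u v :
  all (fun r => fred (proj r.1) == fred (proj r.2)) rels ->
  pres_eq rels u v -> fred (proj u) = fred (proj v).
Proof.
move=> /allP hr; elim=> {u v} //.
- by move=> v u w _ -> _ ->.
- move=> u v l.
  rewrite !proj_cat !fred_cat /= -/(proj v).
  by case: (f l.1) => [t|] //=; rewrite (pushK (t, l.2)) ?fred_reduced.
- by move=> u v lr /hr/eqP lr_eq; rewrite !proj_cat !fred_cat lr_eq.
Qed.

End Presentation.

Notation cl := (@pres_class _ stallings_rels).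

Lemma clM u v : cl (u ++ v) = (cl u * cl v : stallings)%g.
Proof. by rewrite [RHS]pres_class_mul. Qed.

Lemma clV u : cl (winv u) = ((cl u)^-1 : stallings)%g.
Proof. by rewrite [RHS]pres_class_inv. Qed.

Lemma cl_nil : cl [::] = (1 : stallings)%g.
Proof. by []. Qed.

Lemma cl_nseq n l : cl (nseq n l) = (cl [:: l] ^+ n : stallings)%g.
Proof. by elim: n => [|n ih]; rewrite ?expg0 // expgS -ih -clM. Qed.

(** * The three free quotients of Stallings' group *)

Definition to_ab t := match t with La | Lb => Some t | _ => None end.
Definition to_cd t := match t with Lc | Ld => Some t | _ => None end.
(* The quotient F(t, s): a, b, c, d all map to t, which is encoded by La. *)
Definition to_ts t := match t with Ls => Some Ls | _ => Some La end.

Definition weight_s t : int := if t is Ls then 1%R else 0%R.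
Definition weight_t t : int := if t is Ls then 0%R else 1%R.

Lemma esum_proj_ts_s w : esum weight_s (proj to_ts w) = esum weight_s w.
Proof.
by elim: w => [|[t b] w ih] //; case: t; rewrite /= !esum_cons -/(proj _ w) ih.
Qed.

Lemma esum_proj_ts_t w : esum weight_t (proj to_ts w) =
  (esum (fun=> 1) (proj to_ab w) + esum (fun=> 1) (proj to_cd w))%R.
Proof.
elim: w => [|[t b] w ih]; first by rewrite /esum !big_nil.
by case: t; rewrite /= !esum_cons -!/(proj _ w) ih /=; case: b => /=; lia.
Qed.

(** Each letter is counted once on the left: [Ls] in the exponent sum, any other in one of the
    projections. *)
Lemma size_proj_le w :
  ((size (proj to_ab w) + size (proj to_cd w))%:Z + `|esum weight_s w| <=
   (size w)%:Z)%R.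
Proof.
elim: w => [|[t b] w ih]; first by rewrite /esum !big_nil.
by move: ih; case: t; rewrite /= !esum_cons -!/(proj _ w) /=;
  move: (size (proj _ w)) (size (proj _ w)) (esum _ w) => x y e;
  case: b => /=; lia.
Qed.

Section ProjStallings.
Variables (u v : word stallings_letter).
Hypothesis uv : cl u = cl v.

Lemma fred_proj_ab : fred (proj to_ab u) = fred (proj to_ab v).
Proof. by apply: fred_proj_pres_eq (proj1 (pres_classP _ _ _) uv). Qed.

Lemma fred_proj_cd : fred (proj to_cd u) = fred (proj to_cd v).
Proof. by apply: fred_proj_pres_eq (proj1 (pres_classP _ _ _) uv). Qed.

Lemma fred_proj_ts : fred (proj to_ts u) = fred (proj to_ts v).
Proof. by apply: fred_proj_pres_eq (proj1 (pres_classP _ _ _) uv). Qed.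

(** The left side depends only on the group element, the exponent of s being read in F(t, s); so it
    bounds the length of every word for that element. *)
Lemma size_fred_proj_le :
  ((size (fred (proj to_ab u)) + size (fred (proj to_cd u)))%:Z +
     `|esum weight_s u| <= (size v)%:Z)%R.
Proof.
rewrite fred_proj_ab fred_proj_cd -(esum_proj_ts_s u) -esum_fred fred_proj_ts.
rewrite esum_fred esum_proj_ts_s; apply: le_trans (size_proj_le v).
by rewrite lerD2r lez_nat leq_add ?size_fred.
Qed.

End ProjStallings.

(** * Paths in the Cayley graph of Stallings' group *)

Notation X := stallings_X.

Lemma cl_gen t b : cl [:: (t, b)] =
  (if b then (pres_gen stallings_rels t)^-1 else pres_gen stallings_rels t
    : stallings)%g.
Proof. by case: b => //; rewrite -[RHS]clV. Qed.

Lemma cayley_adjP (x y : stallings) :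
  cayley_adj X x y <-> exists l, y = (x * cl [:: l])%g.
Proof.
split=> [/hasP[g gX yx]|[[t b] ->]].
  have [l gl] : exists l, g = cl [:: l].
    rewrite !inE in gX.
    do !case/orP: gX => [/eqP->|gX]; last (move/eqP: gX => ->);
      first [by eexists (_, false); rewrite cl_gen
            |by eexists (_, true); rewrite cl_gen].
  move: yx; rewrite gl => /orP[] /eqP->; first by exists l.
  by exists (linv l); rewrite (clV [:: l]) mulgK.
apply/hasP; exists (cl [:: (t, b)]); last by rewrite eqxx.
by rewrite cl_gen; case: t; case: b; rewrite !inE eqxx ?orbT.
Qed.

Lemma joined_inP (x y : stallings) n :
  joined_in X x y n <-> exists2 w, size w = n & y = (x * cl w)%g.
Proof.
split=> [[p [xp <-] <-]|[w <- ->]].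
  elim: p x xp => [|z p ih] x /=; first by exists [::]; rewrite ?mulg1.
  case/andP=> /cayley_adjP[l ->] /ih[w sw ->].
  by exists (l :: w); rewrite /= ?sw // -mulgA -clM.
elim: w x => [|l w ih] x; first by exists [::]; rewrite // cl_nil mulg1.
have [p [xp lp] sp] := ih (x * cl [:: l])%g.
exists ((x * cl [:: l])%g :: p); last by rewrite /= sp.
split; last by rewrite /= lp -mulgA -clM.
by rewrite /= xp andbT; apply/cayley_adjP; exists l.
Qed.

Lemma cdist_le (x y : stallings) n :
  cdist X x y <= n <-> exists2 w, size w <= n & y = (x * cl w)%g.
Proof.
rewrite /cdist; case: pselect => [h|]; last first.
  (* The default value of [cdist] is excluded, since [X] generates. *)
  by case; have [m hm] := stallings_X_generates x y; exists m; apply/asboolP.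
case: ex_minnP => m /asboolP/joined_inP[w sw yw] minm; split=> [lemn|[v sv yv]].
  by exists w; rewrite ?sw.
by apply: leq_trans (minm _ _) sv; apply/asboolP/joined_inP; exists v.
Qed.

(** The side of s when the tree of F(t, s) is cut along the edge from 1 to s. *)
Definition starts_with_s w := ohead (fred (proj to_ts w)) == Some (Ls, false).

Lemma starts_with_sW u v : cl u = cl v -> starts_with_s u = starts_with_s v.
Proof. by rewrite /starts_with_s => /fred_proj_ts->. Qed.

Lemma cross_letter w l : starts_with_s w -> ~~ starts_with_s (w ++ [:: l]) ->
  fred (proj to_ts w) = [:: (Ls, false)] /\ l = (Ls, true).
Proof.
rewrite /starts_with_s proj_cat fred_cat.
have := fred_reduced (proj to_ts w); case: (fred _) => [|x z] //= red /eqP[ex].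
rewrite {}ex in red *.
(* [to_ts] kills no generator, so the default of [odflt] is never taken. *)
have -> : fred (proj to_ts [:: l]) = [:: (odflt La (to_ts l.1), l.2)].
  by case: l => [[] b].
set l' := (_, l.2).
have [/= ->|[-> ll] _] := head_foldr_push1 l' red; first by rewrite eqxx.
by split=> //; move: ll; rewrite {}/l'; case: l => [[] []].
Qed.

Section Crossing.
Variables (R : realType) (r : nat).

(** At [t = 0] the point is [u]; if the bound comes through [v], one more letter leads from [v] back
    to [u]. *)
Lemma edge_in_ball_cdist (u v : stallings) :
  edge_in_ball X R r u v -> cdist X 1%g u <= r.
Proof.
case=> /cayley_adjP[l vl] /(_ 0%R).
rewrite /edge_point_dist lexx ler01 addr0 subr0 => /(_ isT).
rewrite ge_min natr1 !ler_nat => /orP[//|ltvr].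
have /cdist_le[w sw vw] := leqnn (cdist X 1%g v).
apply/cdist_le; exists (w ++ [:: linv l]).
  by rewrite size_cat addn1 (leq_ltn_trans sw).
by rewrite clM mulgA -vw vl (clV [:: l]) mulgK.
Qed.

(* The image in the tree of F(t, s) of a path that leaves the branch of words
   starting with s crosses the edge from s to 1. *)
Lemma path_cross p w v :
  path (fun x y => `[< edge_in_ball X R r x y >]) (cl w) p ->
  last (cl w) p = cl v -> starts_with_s w -> ~~ starts_with_s v ->
  exists w1 w2, [/\ (size w1 + size w2).+1 = size p,
    fred (proj to_ts (w ++ w1)) = [:: (Ls, false)],
    cdist X 1%g (cl (w ++ w1)) <= r &
    cl v = cl (w ++ w1 ++ (Ls, true) :: w2)].
Proof.
elim: p w => [|y p ih] w /=; first by move=> _ /starts_with_sW->; case: (_ v).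
case/andP=> /asboolP wy yp lp sw sv; have [/cayley_adjP[l yl] _] := wy.
rewrite -clM in yl; rewrite {}yl in wy yp lp.
case: (boolP (starts_with_s (w ++ [:: l]))) => [swl|nswl].
  have [w1 [w2 []]] := ih _ yp lp swl sv; rewrite -!catA /= => sp *.
  by exists (l :: w1), w2; split; rewrite //= -sp.
have [tsw ll] := cross_letter sw nswl.
have xp : path (cayley_adj X) (cl (w ++ [:: l])) p.
  by apply: sub_path yp => x z /asboolP[].
have /joined_inP[w2 sp vw] : joined_in X (cl (w ++ [:: l])) (cl v) (size p).
  by exists p.
exists [::], w2; rewrite cats0 /= -sp; split=> //.
  exact: edge_in_ball_cdist wy.
by rewrite vw -clM -catA ll.
Qed.

End Crossing.

(** * The two vertices *)

(** As c commutes with a and b, conjugating a^-1 b by (a^-1 c)^n amounts to conjugating it by a^-n.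
    This conjugate times a^-n b^n is a^-(n+1) b^(n+1). *)
Lemma commute_expVM (G : groupType) (a b c s : G) n :
  commute a c -> commute b c -> commute s (a^-1 * b)%g ->
  commute s (a^-1 * c)%g -> commute s (a^-1 ^+ n * b ^+ n)%g.
Proof.
move=> ac bc sb sc; elim: n => [|n ih].
  by rewrite !expg0 mulg1; exact: commute1.
have cV : commute a^-1%g c by exact: (commute_sym (commuteV (commute_sym ac))).
have cb : commute (c ^+ n)%g (a^-1 * b)%g.
  apply: commute_sym; apply: commuteX; apply: commute_sym.
  exact: (commuteM (commute_sym cV) (commute_sym bc)).
suff -> : (a^-1 ^+ n.+1 * b ^+ n.+1 = (a^-1 * c) ^+ n * (a^-1 * b) *
            ((a^-1 * c) ^+ n)^-1 * (a^-1 ^+ n * b ^+ n))%g.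
  have sX := commuteX n sc.
  exact: (commuteM (commuteM (commuteM sX sb) (commuteV sX)) ih).
rewrite expgMn // -(mulgA _ (c ^+ n)%g) cb invgM !mulgA mulgK mulgVK.
by rewrite -expgSr -[in RHS]mulgA -expgS.
Qed.

Definition far_word (n m : nat) : word stallings_letter :=
  nseq n (La, true) ++ nseq m (Lb, false).

Lemma far_wordSr n m : far_word n m ++ [:: (Lb, false)] = far_word n m.+1.
Proof. by rewrite /far_word nseqSr catA. Qed.

Lemma s_far_word n :
  cl ((Ls, false) :: far_word n n) = cl (far_word n n ++ [:: (Ls, false)]).
Proof.
have rel u : (u, [::]) \in stallings_rels -> cl u = (1 : stallings)%g.
  move=> ur; apply/pres_classP.
  by have := pres_rel [::] [::] ur; rewrite /= cats0.
have comm_of (x y : word stallings_letter) :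
    (wcomm x y, [::]) \in stallings_rels ->
    commute (cl x : stallings) (cl y : stallings).
  move/rel; rewrite /wcomm /wmul !clM !clV => /divg1_eq h.
  by rewrite /commute -[cl y in RHS]h mulgVK.
have conj_of (x y : word stallings_letter) :
    (wconj x y, x) \in stallings_rels ->
    commute (cl y : stallings) (cl x : stallings).
  move=> xr; have /pres_classP := pres_rel [::] [::] xr.
  rewrite /= !cats0 /wconj /wmul !clM clV => h.
  by rewrite /commute -[cl x in RHS]h mulgVK.
rewrite -cat1s !clM !cl_nseq cl_gen cl_gen.
(* The auxiliary element is c. *)
apply: (@commute_expVM _ _ _ (cl [:: (Lc, false)])).
- exact: (comm_of (wgen La) (wgen Lc)).
- exact: (comm_of (wgen Lb) (wgen Lc)).
- by have := conj_of (wmul (winv (wgen La)) (wgen Lb)) (wgen Ls) isT;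
    rewrite /wmul clM clV.
- by have := conj_of (wmul (winv (wgen La)) (wgen Lc)) (wgen Ls) isT;
    rewrite /wmul clM clV.
Qed.

(** * Lengths of the two vertices *)

Lemma proj_far_word n m :
  [/\ proj to_ab (far_word n m) = far_word n m,
      proj to_cd (far_word n m) = [::] &
      proj to_ts (far_word n m) = nseq n (La, true) ++ nseq m (La, false)].
Proof. by split; rewrite proj_cat !proj_nseq. Qed.

(** Such a [w] attains the lower bound of [size_fred_proj_le], so it is geodesic. *)
Lemma cdist1_eq (w : word stallings_letter) :
  ((size w)%:Z <= (size (fred (proj to_ab w)) +
     size (fred (proj to_cd w)))%:Z + `|esum weight_s w|)%R ->
  cdist X 1%g (cl w : stallings) = size w.
Proof.
move=> lew; apply/eqP; rewrite eqn_leq; apply/andP; split.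
  by apply/cdist_le; exists w; rewrite ?mul1g.
have /cdist_le[v sv] := leqnn (cdist X 1%g (cl w : stallings)).
rewrite mul1g => /size_fred_proj_le wv.
by apply: leq_trans sv; rewrite -lez_nat (le_trans lew).
Qed.

Lemma esum_cat (T : choiceType) f (u v : word T) :
  esum f (u ++ v) = (esum f u + esum f v)%R.
Proof. exact: big_cat. Qed.

Lemma esum_far_word n m : esum weight_s (far_word n m) = 0%R.
Proof.
rewrite esum_cat /esum !big1_seq ?addr0 // => l /andP[_];
by rewrite mem_nseq => /andP[_ /eqP->].
Qed.

Lemma fred_far_word n m : fred (far_word n m) = far_word n m.
Proof. exact: fred_nseq2. Qed.

Lemma size_far_word n m : size (far_word n m) = n + m.
Proof. by rewrite size_cat !size_nseq. Qed.

Lemma cdist_far_word n m : cdist X 1%g (cl (far_word n m) : stallings) = n + m.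
Proof.
rewrite cdist1_eq ?size_far_word //; have [-> -> _] := proj_far_word n m.
by rewrite esum_far_word fred_far_word size_far_word normr0 addr0 addn0.
Qed.

Lemma cdist_s_far_word n m :
  cdist X 1%g (cl ((Ls, false) :: far_word n m) : stallings) = (n + m).+1.
Proof.
rewrite cdist1_eq /= ?size_far_word // -!/(proj _ (far_word n m)).
have [-> -> _] := proj_far_word n m.
by rewrite esum_cons esum_far_word fred_far_word size_far_word /= addr0; lia.
Qed.

(** The image in F(t, s) is s t^-1. *)
Lemma starts_with_s_far_word n : starts_with_s ((Ls, false) :: far_word n.+1 n).
Proof.
have [_ _ ts] := proj_far_word n.+1 n.
rewrite /starts_with_s -cat1s proj_cat ts fred_cat /= -/(fred _).
by rewrite (fred_nseqV n (La, false)).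
Qed.

Lemma proj_winv (T T' : choiceType) (f : T -> option T') w :
  proj f (winv w) = winv (proj f w).
Proof.
elim: w => // l w ih; rewrite -cat1s winv_cat !proj_cat winv_cat ih.
by congr (_ ++ _); rewrite /winv /=; case: (f l.1).
Qed.

Lemma winv_nseq (T : choiceType) n (l : T * bool) :
  winv (nseq n l) = nseq n (linv l).
Proof. by rewrite /winv map_nseq rev_nseq. Qed.

(** [g] represents w^-1 z, with images b^-m a^n u and v, where u and v are those of [z].
    [size_foldr_push_far] bounds their total length below. *)
Lemma size_from_far_word n m (w z g : word stallings_letter) :
  proj to_ab w = far_word n m -> proj to_cd w = [::] ->
  (esum (fun=> 1) (proj to_ab z) + esum (fun=> 1) (proj to_cd z) = 0)%R ->
  size (fred (proj to_ab z)) + size (fred (proj to_cd z)) < 2 * n ->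
  cl z = cl (w ++ g) -> m + n <= size g.
Proof.
move=> wab wcd e0 ltn zwg.
have gz : cl g = cl (winv w ++ z).
  by rewrite clM zwg clM clV mulKg.
have := size_fred_proj_le (esym gz); rewrite !proj_cat !proj_winv wab wcd /=.
rewrite {1}/fred foldr_cat -/(fred _) winv_cat !winv_nseq => le_g.
rewrite -(esum_fred _ (proj to_ab z)) -(esum_fred _ (proj to_cd z)) in e0.
have far := size_foldr_push_far (l := (La, false)) (l1 := (Lb, true)) m
  erefl isT e0 ltn.
apply: leq_trans far _.
by rewrite -lez_nat; apply: le_trans le_g; rewrite lerDl.
Qed.

Theorem theorem5p3 (R : realType) : ~ minimally_almost_convex stallings_X R.
Proof.
(* The radius 2n exceeds the threshold [m], and x has exponent n - 1 = [m]. *)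
case=> m acm; set n := m.+1.
have [||||p [_ xp lp] sp] := acm (2 * n) _
  (cl ((Ls, false) :: far_word n m)) (cl (far_word n n)).
- by rewrite /n; lia.
- by rewrite /in_sphere cdist_s_far_word /n; lia.
- by rewrite /in_sphere cdist_far_word addnn mul2n.
- apply/cdist_le; exists [:: (Lb, false); (Ls, true)] => //.
  have xe : ((Ls, false) :: far_word n m) ++ [:: (Lb, false); (Ls, true)] =
            ((Ls, false) :: far_word n n) ++ winv (wgen Ls).
    have /esym fE := far_wordSr n m; rewrite [far_word n n]fE.
    exact: (catA (_ :: far_word n m) [:: (Lb, false)]).
  rewrite -clM xe (clM (_ :: far_word n n)) s_far_word.
  by rewrite (clM (far_word n n)) clV mulgK.
have nsy : ~~ starts_with_s (far_word n n).
  rewrite /starts_with_s; have [_ _ ->] := proj_far_word n n.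
  by rewrite (fred_nseqV n (La, false)).
(* The path follows [w1] from x to h s, spelled by [z] below, crosses by s^-1 to h, and follows [w2]
   to y. *)
have [w1 [w2 [sz]]] := path_cross xp lp (starts_with_s_far_word m) nsy.
set z := _ ++ w1; rewrite catA -/z -[_ :: w2]cat1s (catA z) => tsz zr yz.
have zE : cl z = cl (((Ls, false) :: far_word n m) ++ w1) by [].
move: zE tsz zr yz; clearbody z => zE tsz zr yz.
have e0 : (esum (fun=> 1) (proj to_ab z) + esum (fun=> 1) (proj to_cd z) = 0)%R.
  by rewrite -esum_proj_ts_t -esum_fred tsz /esum big_seq1.
have es : esum weight_s z = 1%R.
  by rewrite -esum_proj_ts_s -esum_fred tsz /esum big_seq1.
(* The exponent 1 of s takes one unit of the radius 2n, whence the strict bound. *)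
have ltz : size (fred (proj to_ab z)) + size (fred (proj to_cd z)) < 2 * n.
  have [q sq] := (proj1 (cdist_le _ _ _) zr).
  rewrite mul1g => /size_fred_proj_le; rewrite es normr1 addrC => zq.
  by apply: leq_trans sq; rewrite -lez_nat.
have [fab fcd _] := proj_far_word n m; have [gab gcd _] := proj_far_word n n.
have le1 : m + n <= size w1.
  by apply: (@size_from_far_word n m ((Ls, false) :: far_word n m) z).
(* Read backwards, [w2] leads from y to h, whose images in F(a,b) and F(c,d) are those of [z]. *)
have le2 : n + n <= size (winv w2).
  apply: (@size_from_far_word n n (far_word n n) (z ++ [:: (Ls, true)])) => //;
    rewrite ?(proj_cat _ z) ?cats0 //.
  by rewrite (clM (far_word n n)) yz clV (clM (z ++ _)) mulgK.
(* With the crossing edge, the length is at least (2n - 1) + 1 + 2n = 4n, against the bound 4n -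
   1. *)
move: sp; rewrite -sz -natrM lerBrDr natr1 ler_nat.
by move: le2; rewrite size_rev size_map /n in le1 *; lia.
Qed.
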